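(* Let $X$ be a smooth Banach space over $\mathbb{C}$. If $T\in B(X)$ is such that $T-c(T)I$ is a strongly normal operator on $X$, then $\mu(T)=c(T)$.
   Context: $B(X)$ is the space of bounded linear operators on $X$, $S_X=\{x\in X:\|x\|=1\}$, $X^*$ is the space of bounded linear functionals on $X$. $X$ is smooth if every $x\in S_X$ admits a unique $x^*\in S_{X^*}$ with $x^*(x)=1$. The duality mapping $J:X\to X^*$ of a smooth Banach space assigns to each $x$ the unique functional $J(x)$ with $\|J(x)\|=\|x\|$ and $J(x)(x)=\|x\|^2$. For $T\in B(X)$ the transpose $T':X^*\to X^*$ is $(T'f)(x)=f(Tx)$. $T\in B(X)$ is self-adjoint if $T'\circ J=J\circ T$; $T$ is strongly normal if $T=S^2$ for some self-adjoint $S\in B(X)$. The minimum modulus is $\mu(T)=\inf\{\|Tx\|:x\in S_X\}$. The numerical range is $W(T)=\{x^*(Tx):x\in S_X,\ x^*\in S_{X^*},\ x^*(x)=1\}$ (so $W(T)=\{J(x)(Tx):x\in S_X\}$), and the Crawford number is $c(T)=\inf\{|\lambda|:\lambda\in W(T)\}$. *)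

(* Defs.v *)
From HB Require Import structures.
From mathcomp Require Export all_boot all_order all_algebra complex.
From mathcomp Require Export all_classical all_reals all_analysis.

Set Implicit Arguments.
Unset Strict Implicit.
Unset Printing Implicit Defensive.

Import Order.TTheory GRing.Theory Num.Theory.
Import numFieldNormedType.Exports.

Local Open Scope classical_set_scope.
Local Open Scope ring_scope.

Section BoundedLinear.
Variable R : realType.

(* [`|x|] lies in [R[i]], which is only partially ordered; [rnorm x] is the same
   number seen in [R], where suprema and infima are available. *)
Definition rnorm (V : normedModType R[i]) (x : V) : R := complex.Re `|x|.

Definition sphere (V : normedModType R[i]) : set V := [set x | `|x| = 1].

Record bop (V W : normedModType R[i]) := Bop {
  bop_fun :> {linear V -> W} ;
  bop_bounded : bounded_near bop_fun (nbhs (0 : V)) }.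

HB.instance Definition _ V W := gen_eqMixin (bop V W).
HB.instance Definition _ V W := gen_choiceMixin (bop V W).

Lemma bop_continuous (V W : normedModType R[i]) (f : bop V W) : continuous f.
Proof. exact/linear_bounded_continuous/bop_bounded. Qed.

Lemma bop_ext (V W : normedModType R[i]) (f g : bop V W) : f =1 g -> f = g.
Proof.
case: f => [[f [[Df] [Zf]]] bf]; case: g => [[g [[Dg] [Zg]]] bg] /= fg.
move: Df Zf bf Dg Zg bg; have {fg}-> : f = g by apply: funext.
move=> Df Zf bf Dg Zg; rewrite (Prop_irrelevance Df Dg) in bf *.
rewrite (Prop_irrelevance Zf Zg) in bf * => bg.
by rewrite (Prop_irrelevance bf bg).
Qed.

Section Operations.
Variables U V W : normedModType R[i].

Lemma bop_zero_bounded : bounded_near (\0 : {linear V -> W}) (nbhs (0 : V)).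
Proof. apply/linear_bounded_continuous; exact: cst_continuous. Qed.
Definition bop_zero : bop V W := Bop bop_zero_bounded.

Lemma bop_id_bounded : bounded_near (idfun : {linear V -> V}) (nbhs (0 : V)).
Proof. by apply/linear_bounded_continuous => x. Qed.
Definition bop_id : bop V V := Bop bop_id_bounded.

Lemma bop_comp_bounded (g : bop V W) (f : bop U V) :
  bounded_near (g \o f : {linear U -> W}) (nbhs (0 : U)).
Proof.
apply/linear_bounded_continuous => x.
by apply: continuous_comp; exact: bop_continuous.
Qed.
Definition bop_comp (g : bop V W) (f : bop U V) : bop U W :=
  Bop (bop_comp_bounded g f).

Lemma bop_sub_bounded (f g : bop V W) :
  bounded_near (f \- g : {linear V -> W}) (nbhs (0 : V)).
Proof.
apply/linear_bounded_continuous => x.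
by apply: continuousB; exact: bop_continuous.
Qed.
Definition bop_sub (f g : bop V W) : bop V W := Bop (bop_sub_bounded f g).

Lemma bop_scale_bounded (a : R[i]) (f : bop V W) :
  bounded_near (a \*: f : {linear V -> W}) (nbhs (0 : V)).
Proof.
apply/linear_bounded_continuous => x.
apply: continuous_comp; first exact: bop_continuous.
exact: scaler_continuous.
Qed.
Definition bop_scale (a : R[i]) (f : bop V W) : bop V W :=
  Bop (bop_scale_bounded a f).

End Operations.

Definition dual (V : normedModType R[i]) := bop V R[i]^o.

Definition dual_norm (V : normedModType R[i]) (f : dual V) : R :=
  sup [set rnorm (f x) | x in [set x : V | `|x| <= 1]].

Definition transpose (V W : normedModType R[i]) (T : bop V W) (f : dual W) :
  dual V := bop_comp f T.

End BoundedLinear.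

Arguments sphere {R} V.
Arguments bop_zero {R} V W.
Arguments bop_id {R} V.

Section Operators.
Variables (R : realType) (X : normedModType R[i]).

Definition smooth : Prop :=
  forall x : X, sphere X x ->
    exists! f : dual X, dual_norm f = 1 /\ f x = 1.

(* In a smooth space exactly one functional satisfies the condition, so the
   default value of [xget] is irrelevant there. *)
Definition duality_map (x : X) : dual X :=
  xget (bop_zero X R[i]^o)
    [set f | dual_norm f = rnorm x /\ f x = `|x| ^+ 2].

Definition self_adjoint (T : bop X X) : Prop :=
  transpose T \o duality_map = duality_map \o T.

Definition strongly_normal (T : bop X X) : Prop :=
  exists S : bop X X, self_adjoint S /\ T = bop_comp S S.

(* The infima below are taken over empty sets, hence equal to 0, exactly when
   the space is trivial. *)
Definition min_modulus (T : bop X X) : R :=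
  inf [set rnorm (T x) | x in sphere X].

Definition numerical_range (T : bop X X) : set R[i] :=
  [set z | exists x (f : dual X),
    [/\ sphere X x, dual_norm f = 1, f x = 1 & z = f (T x)]].

Definition crawford_number (T : bop X X) : R :=
  inf [set rnorm (z : R[i]^o) | z in numerical_range T].

End Operators.

Arguments smooth {R} X.

(* Main.v *)
Require Import Defs.

(** Write [c] for the Crawford number of [T], [J] for the duality map and
    [T = c I + S^2] with [S] self-adjoint. The functionals occurring in the
    numerical range are exactly the [J x] with [`|x| = 1], and self-adjointness
    at [x], evaluated at [S x], gives [J x (S (S x)) = J (S x) (S x) = `|S x| ^+ 2]
    ([self_adjoint_sqr]); hence

      [J x (T x) = c + `|S x| ^+ 2]   for every unit vector [x].

    The numerical range is therefore a set of reals at least [c], and since its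
    infimum is [c], unit vectors [x] exist with [`|S x|] as small as desired:
    [S] is not bounded below. Both inequalities follow. On the one hand
    [`|T x|] is at least [`|J x (T x)|], which is at least [c]. On the other
    hand [`|T x|] is at most [c + `|S (S x)|], hence at most [c + M * `|S x|]
    for any bound [M] of [S], and this comes arbitrarily close to [c].

    Self-adjointness only speaks of the chosen map [J], so it must be known that
    [J y] really norms [y] ([duality_mapP]); this is the one place where
    existence of support functionals is used away from the unit sphere, and it
    is obtained by scaling. *)

Set Implicit Arguments.
Unset Strict Implicit.
Unset Printing Implicit Defensive.

Import Order.TTheory GRing.Theory Num.Theory.
Import numFieldNormedType.Exports.

Local Open Scope classical_set_scope.
Local Open Scope ring_scope.

Section RealNorm.
Variable R : realType.
Implicit Types V W : normedModType R[i].

Lemma rnormE V (x : V) : `|x| = (rnorm x)%:C%C.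
Proof. by rewrite /rnorm RRe_real // normr_real. Qed.

Lemma rnorm_ge0 V (x : V) : 0 <= rnorm x.
Proof. by rewrite -lecR -rnormE normr_ge0. Qed.

Lemma ler_rnormD V (x y : V) : rnorm (x + y) <= rnorm x + rnorm y.
Proof. by rewrite -lecR rmorphD /= -!rnormE ler_normD. Qed.

Lemma rnormZ V (a : R) (x : V) : 0 <= a -> rnorm (a%:C%C *: x) = a * rnorm x.
Proof.
move=> a0; apply: (@complexI R); rewrite rmorphM /= -!rnormE normrZ.
by rewrite ger0_norm // lecR.
Qed.

Lemma rnorm_sphere V (x : V) : sphere V x -> rnorm x = 1.
Proof. by rewrite /sphere /= /rnorm => ->. Qed.

Lemma rnorm_real (a : R) : 0 <= a -> rnorm (a%:C%C : R[i]^o) = a.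
Proof.
by move=> a0; apply: (@complexI R); rewrite -rnormE ger0_norm // lecR.
Qed.

Lemma bop_rnorm_bound V W (f : bop V W) :
  exists2 M : R, 0 < M & forall x, rnorm (f x) <= M * rnorm x.
Proof.
have /linear_boundedP/pinfty_ex_gt0 [M M0 fM] := bop_bounded f.
have ME : M = (complex.Re M)%:C%C by rewrite RRe_real // gtr0_real.
exists (complex.Re M); first by rewrite -ltcR -ME.
by move=> x; rewrite -lecR rmorphM /= -ME -!rnormE.
Qed.

(** Suprema in [R] are 0 by convention on sets without a bound, so every estimate
    on [dual_norm] goes through this. *)
Lemma has_sup_dual_norm V (f : dual V) :
  has_sup [set rnorm (f x) | x in [set x : V | `|x| <= 1]].
Proof.
split; first by exists (rnorm (f 0)), 0 => //=; rewrite normr0 ler01.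
have [M M0 fM] := bop_rnorm_bound f.
exists M => _ [x /= x1 <-]; apply: le_trans (fM x) _.
by rewrite ger_pMr // -lecR -rnormE.
Qed.

Lemma sphere_dilation V (x : V) : x != 0 ->
  exists2 u : V, sphere V u & x = (rnorm x)%:C%C *: u.
Proof.
move=> x0; have a0 : 0 < rnorm x by rewrite -ltcR -rnormE normr_gt0.
exists ((rnorm x)^-1%:C%C *: x); last first.
  by rewrite scalerA -rmorphM /= mulfV ?gt_eqF // scale1r.
by rewrite /sphere /= rnormE rnormZ ?mulVf ?gt_eqF // invr_ge0 ltW.
Qed.

Lemma ler_dual_norm V (f : dual V) (x : V) :
  rnorm (f x) <= dual_norm f * rnorm x.
Proof.
have [->|/sphere_dilation[u u1 ->]] := eqVneq x 0.
  by rewrite linear0 /rnorm !normr0 mulr0.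
rewrite linearZ /= !rnormZ ?rnorm_ge0 // (rnorm_sphere u1) mulr1 mulrC.
rewrite ler_wpM2r ?rnorm_ge0 //.
apply: ub_le_sup; first by have [] := has_sup_dual_norm f.
by exists u => //=; rewrite u1.
Qed.

Lemma dual_normZ V (a : R) (f : dual V) : 0 < a ->
  dual_norm (bop_scale a%:C%C f) = a * dual_norm f.
Proof.
move=> a0; have afE x : rnorm (bop_scale a%:C%C f x) = a * rnorm (f x).
  by rewrite -rnormZ // ltW.
have [ne ub] := has_sup_dual_norm f.
have [nea uba] := has_sup_dual_norm (bop_scale a%:C%C f).
apply/eqP; rewrite eq_le; apply/andP; split.
  apply: ge_sup nea _ => _ [x x1 <-]; rewrite afE ler_pM2l //.
  by apply: (ub_le_sup ub); exists x.
rewrite -ler_pdivlMl //; apply: ge_sup ne _ => _ [x x1 <-].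
rewrite ler_pdivlMl // -afE.
by apply: (ub_le_sup uba); exists x.
Qed.

End RealNorm.

Section DualityMap.
Variables (R : realType) (X : normedModType R[i]).
Hypothesis hX : smooth X.

(** Smoothness provides a support functional at [y / `|y|]; multiplied by [`|y|]
    it meets the two conditions by which the duality map is chosen. *)
Lemma duality_mapP (y : X) : y != 0 ->
  dual_norm (duality_map y) = rnorm y /\ duality_map y y = `|y| ^+ 2.
Proof.
move=> y0; have [u u1 yE] := sphere_dilation y0.
have [f [[f1 fu] _]] := hX u1.
apply: (@xgetPex _ _ [set f : dual X |
  dual_norm f = rnorm y /\ f y = `|y| ^+ 2]).
exists (bop_scale (rnorm y)%:C%C f); split.
  by rewrite dual_normZ ?f1 ?mulr1 // -ltcR -rnormE normr_gt0.
by rewrite /= {2}yE linearZ /= fu /GRing.scale /= mulr1 -rnormE expr2.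
Qed.

(** At [y = 0] linearity alone gives the value, whichever functional is
    chosen there; so this form holds for all [y]. *)
Lemma duality_map_self (y : X) : duality_map y y = `|y| ^+ 2.
Proof.
have [->|/duality_mapP[]//] := eqVneq y 0.
by rewrite linear0 normr0 expr0n.
Qed.

(** Uniqueness of the support functional: the numerical range of an operator only
    involves functionals in the image of the duality map, the ones about which
    self-adjointness gives information. *)
Lemma support_functional_duality (x : X) (f : dual X) : sphere X x ->
  dual_norm f = 1 -> f x = 1 -> f = duality_map x.
Proof.
move=> x1 nf fx.
have x0 : x != 0 by rewrite -normr_eq0 x1 oner_neq0.
have [nJ Jx] := duality_mapP x0.
have [g [_ gU]] := hX x1.
rewrite -(gU f) // (gU (duality_map x)) //; split.
  by rewrite nJ rnorm_sphere.
by rewrite Jx x1 expr1n.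
Qed.

(** Self-adjointness at [x], evaluated at [S x], replaces [J x (S (S x))] by
    [J (S x) (S x)]. *)
Lemma self_adjoint_sqr (S : bop X X) (x : X) : self_adjoint S ->
  duality_map x (S (S x)) = `|S x| ^+ 2.
Proof.
move=> hS; rewrite -duality_map_self.
by have /(congr1 (fun g : dual X => g (S x))) := congr1 (@^~ x) hS.
Qed.

(** Smoothness gives at least one support functional at [x], so the Crawford
    number is a genuine infimum. *)
Lemma has_inf_numerical_range (T : bop X X) (x : X) : sphere X x ->
  has_inf [set rnorm (z : R[i]^o) | z in numerical_range T].
Proof.
move=> x1; have [f [[f1 fx] _]] := hX x1; split.
  by exists (rnorm (f (T x))), (f (T x)) => //; exists x, f.
by exists 0 => _ [z _ <-]; exact: rnorm_ge0.
Qed.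

End DualityMap.

Theorem proposition5 (R : realType) (X : completeNormedModType R[i])
  (hX : smooth X) (T : bop X X)
  (hT : strongly_normal
          (bop_sub T (bop_scale (crawford_number T)%:C%C (bop_id X)))) :
  min_modulus T = crawford_number T.
Proof.
case: hT => S [hS TE]; set c := crawford_number T in TE *.
have Tx x : T x = c%:C%C *: x + S (S x).
  have /= <- := congr1 (fun b : bop X X => b x) TE.
  by rewrite addrC subrK.
(* Without unit vectors both infima range over the empty set, so both are 0. *)
have [[x0 x01]|noX] := pselect (sphere X !=set0); last first.
  have sX0 : sphere X = set0 by apply/eqP; apply/negP => /negP/set0P.
  rewrite /c /crawford_number /min_modulus sX0 image_set0.
  suff -> : numerical_range T = set0 by rewrite image_set0.
  by apply/seteqP; split=> // z [x [f []]]; rewrite sX0.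
have hW := has_inf_numerical_range hX T x01.
have c0 : 0 <= c by apply: lb_le_inf (hW.1) _ => _ [z _ <-]; exact: rnorm_ge0.
have WE x (f : dual X) : sphere X x -> dual_norm f = 1 -> f x = 1 ->
    rnorm (f (T x)) = c + rnorm (S x) ^+ 2.
  move=> x1 f1 fx; rewrite Tx linearD linearZ /= fx.
  rewrite (support_functional_duality hX x1 f1 fx) self_adjoint_sqr //.
  rewrite rnormE -rmorphXn /= /GRing.scale /= mulr1 -rmorphD /= rnorm_real //.
  by rewrite addr_ge0 // exprn_ge0 // rnorm_ge0.
have ne : [set rnorm (T x) | x in sphere X] !=set0.
  by exists (rnorm (T x0)), x0.
have lb : lbound [set rnorm (T x) | x in sphere X] c.
  move=> _ [x x1 <-]; have [f [[f1 fx] _]] := hX _ x1.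
  apply: (@le_trans _ _ (rnorm (f (T x)))).
    by rewrite WE // lerDl exprn_ge0 // rnorm_ge0.
  by have := ler_dual_norm f (T x); rewrite f1 mul1r.
apply/eqP; rewrite eq_le; apply/andP; split; last exact: lb_le_inf.
apply/ler_addgt0Pr => e e0.
have [M M0 SM] := bop_rnorm_bound S.
have d0 : 0 < (e / M) ^+ 2 by rewrite exprn_gt0 // divr_gt0.
(* A value of the numerical range within [(e / M) ^+ 2] of [c] comes from a unit
   vector [x] with [`|S x| < e / M], whence [`|S (S x)| < e]. *)
have [_ [_ [x [f [x1 f1 fx ->]]] <-]] := inf_adherent d0 hW.
rewrite WE // -/(crawford_number T) -/c ltrD2l => Sx.
have {}Sx : rnorm (S x) < e / M.
  by rewrite ltr_pXn2r // ?nnegrE ?rnorm_ge0 // divr_ge0 // ltW in Sx.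
apply: (@le_trans _ _ (rnorm (T x))).
  by apply: ge_inf; [exists c | exists x].
rewrite Tx; apply: le_trans (ler_rnormD _ _) _.
rewrite rnormZ // (rnorm_sphere x1) mulr1 lerD2l.
by apply: le_trans (SM _) _; rewrite mulrC -ler_pdivlMr // ltW.
Qed.
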